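(* Let $S$ be a monoid and let $A$ be a quasi-projective strongly co-Hopfian right $S$-act whose endomorphism monoid $\mathrm{End}_S(A)$ is commutative. Then $A$ is strongly Hopfian.
   Context: $S$ is a monoid. A (right) $S$-act is a non-empty set $A$ with a map $A\times S\to A$, $(a,s)\mapsto as$, satisfying $a1=a$ and $a(st)=(as)t$ for all $a\in A$, $s,t\in S$. An $S$-homomorphism (or $S$-act map) $f:A\to B$ is a map with $f(as)=f(a)s$ for all $a\in A$, $s\in S$; $\mathrm{End}_S(A)$ is the monoid of $S$-homomorphisms $A\to A$ (endomorphisms) under composition. An $S$-act $A$ is quasi-projective if for every $S$-act $B$, every surjective $S$-homomorphism $g:A\to B$ and every $S$-homomorphism $f:A\to B$, there exists an endomorphism $h$ of $A$ such that $f=gh$. For $f\in \mathrm{End}_S(A)$ put $\mathcal{K}_f=\{(a_1,a_2)\in A\times A\mid f(a_1)=f(a_2)\}$ and $\mathcal{I}_f=(\mathrm{im} f\times \mathrm{im} f)\cup\Delta_A$, where $\Delta_A=\{(a,a)\mid a\in A\}$. The $S$-act $A$ is strongly Hopfian if for every $f\in\mathrm{End}_S(A)$ the ascending chain $\mathcal{K}_f\subseteq \mathcal{K}_{f^2}\subseteq\cdots$ stabilizes, i.e. there is a positive integer $n$ with $\mathcal{K}_{f^m}=\mathcal{K}_{f^n}$ for all $m\ge n$. It is strongly co-Hopfian if for every $f\in\mathrm{End}_S(A)$ the descending chain $\mathcal{I}_f\supseteq \mathcal{I}_{f^2}\supseteq\cdots$ stabilizes, i.e. there is a positive integer $n$ with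 $\mathcal{I}_{f^m}=\mathcal{I}_{f^n}$ for all $m\ge n$. *)

(* Defs.v *)
From HB Require Import structures.
From mathcomp Require Import all_boot.
From mathcomp Require Import boolp classical_sets.

Set Implicit Arguments.
Unset Strict Implicit.
Unset Printing Implicit Defensive.

Local Open Scope classical_set_scope.
Local Open Scope group_scope.

(* The monoid S is a monoidType, which bundles a choice operator; this is no
   restriction since classically every type carries one. *)

Record act (S : monoidType) := Act {
  act_sort :> Type;
  act_op : act_sort -> S -> act_sort;
  act_nonempty : inhabited act_sort;
  act_op1 : forall a, act_op a 1 = a;
  act_opM : forall a s t, act_op a (s * t) = act_op (act_op a s) t }.

Record hom (S : monoidType) (A B : act S) := Hom {
  hom_fun :> A -> B;
  homP : forall a s, hom_fun (act_op a s) = act_op (hom_fun a) s }.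

Definition End (S : monoidType) (A : act S) := hom A A.

Definition quasi_projective (S : monoidType) (A : act S) :=
  forall (B : act S) (g f : hom A B),
    (forall b : B, exists a : A, g a = b) ->
    exists h : End A, f =1 g \o h.

Section EndMonoid.
Variables (S : monoidType) (A : act S).
Implicit Types f g h : End A.

Lemma hom_ext f g : f =1 g -> f = g.
Proof.
case: f g => [f fP] [g gP] /= /funext fg; case: _ / fg gP => gP.
by congr Hom; exact: Prop_irrelevance.
Qed.

Lemma end_one_subproof a s : idfun (act_op a s) = act_op (idfun a : A) s.
Proof. by []. Qed.

Definition end_one : End A := Hom end_one_subproof.

Lemma end_mul_subproof f g a s :
  (f \o g) (act_op a s) = act_op ((f \o g) a) s.
Proof. by rewrite /= !homP. Qed.

Definition end_mul f g : End A := Hom (end_mul_subproof f g).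

Lemma end_mulA : associative end_mul.
Proof. by move=> f g h; exact: hom_ext. Qed.

Lemma end_mul1g : left_id end_one end_mul.
Proof. by move=> f; exact: hom_ext. Qed.

Lemma end_mulg1 : right_id end_one end_mul.
Proof. by move=> f; exact: hom_ext. Qed.

HB.instance Definition _ := gen_eqMixin (End A).
HB.instance Definition _ := gen_choiceMixin (End A).
HB.instance Definition _ :=
  isMonoid.Build (End A) end_mulA end_mul1g end_mulg1.

End EndMonoid.

Definition ker_rel (S : monoidType) (A : act S) (f : End A) : set (A * A) :=
  [set p | f p.1 = f p.2].

Definition im_rel (S : monoidType) (A : act S) (f : End A) : set (A * A) :=
  (range f `*` range f) `|` diagonal.

Definition strongly_Hopfian (S : monoidType) (A : act S) :=
  forall f : End A, exists2 n : nat, (0 < n)%N &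
    forall m : nat, (n <= m)%N -> ker_rel (f ^+ m) = ker_rel (f ^+ n).

Definition strongly_coHopfian (S : monoidType) (A : act S) :=
  forall f : End A, exists2 n : nat, (0 < n)%N &
    forall m : nat, (n <= m)%N -> im_rel (f ^+ m) = im_rel (f ^+ n).

(* Main.v *)
Require Import Defs.
From mathcomp Require Import all_boot.
From mathcomp Require Import boolp classical_sets.

(** Let [f] be an endomorphism of [A], and let [n] be the index at which the
    relations [im_rel (f ^+ n)] stabilize.  An image relation determines the
    image of a homomorphism unless that image is a single point; since the
    images of the powers of [f] decrease and are never empty, the images
    themselves stabilize at [n] in all cases ([im_rel_subset_range]).

    Fix [m >= n].  Both [f ^+ n] and [f ^+ m] are then maps from [A] to the
    common image, and [f ^+ m] is onto it, so quasi-projectivity yields an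
    endomorphism [h] with [f ^+ n = f ^+ m * h] ([quasi_projective_factor]).
    Commutativity turns this into [f ^+ n = h * f ^+ m], and a left factor only
    enlarges the kernel: [ker_rel (f ^+ m)] is contained in [ker_rel (f ^+ n)].
    The reverse inclusion is clear, so the kernels stabilize at [n] too. *)

Set Implicit Arguments.
Unset Strict Implicit.
Unset Printing Implicit Defensive.

Local Open Scope classical_set_scope.
Local Open Scope group_scope.

Section Endomorphisms.
Variables (S : monoidType) (A : act S).
Implicit Types f g h : End A.

Lemma range_mul_subset f g : range (f * g) `<=` range f.
Proof. by move=> _ [a _ <-]; exists (g a). Qed.

Lemma ker_rel_mul_subset h f : ker_rel f `<=` ker_rel (h * f).
Proof. by move=> p fp; exact: (congr1 h fp). Qed.

Lemma im_rel_subset_range f g :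
  range f `<=` range g -> im_rel g `<=` im_rel f -> range g `<=` range f.
Proof.
move=> fg gf y gy.
have [a] := act_nonempty A.
(* [f a] lies in both images: either it is [y], or [(y, f a)] is an
   off-diagonal pair of [im_rel g]. *)
have fa : range f (f a) by exists a.
have [[]//|/= yfa] := gf (y, f a) (or_introl (conj gy (fg _ fa))).
by rewrite -[y]/(y, f a).1 yfa.
Qed.

End Endomorphisms.

Section ImageAct.
Variables (S : monoidType) (A B : act S) (g : hom A B).

Lemma range_act_op b s : range g b -> range g (act_op b s).
Proof. by move=> [a _ <-]; exists (act_op a s); rewrite ?homP. Qed.

Lemma image_ext (b c : {b : B | range g b}) : sval b = sval c -> b = c.
Proof. by case: b c => [b gb] [c gc]; exact: eq_exist. Qed.

Definition image_op (b : {b : B | range g b}) (s : S) : {b : B | range g b} :=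
  exist _ (act_op (sval b) s) (range_act_op s (svalP b)).

Lemma image_nonempty : inhabited {b : B | range g b}.
Proof. by have [a] := act_nonempty A; split; exists (g a); exists a. Qed.

Lemma image_op1 b : image_op b 1 = b.
Proof. exact/image_ext/act_op1. Qed.

Lemma image_opM b s t : image_op b (s * t) = image_op (image_op b s) t.
Proof. exact/image_ext/act_opM. Qed.

(** The image of a homomorphism, as a subact of its codomain. *)
Definition image_act : act S := Act image_nonempty image_op1 image_opM.

Section Corestriction.
Variables (f : hom A B) (fg : range f `<=` range g).

Definition corestr_fun (a : A) : image_act :=
  exist _ (f a) (fg (imageT f a)).

Lemma corestr_subproof a s :
  corestr_fun (act_op a s) = act_op (corestr_fun a) s.
Proof. exact/image_ext/homP. Qed.

(** A homomorphism whose image lies in that of [g], viewed as a homomorphism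
    into the image of [g]. *)
Definition corestr : hom A image_act := Hom corestr_subproof.

End Corestriction.
End ImageAct.

Lemma quasi_projective_factor (S : monoidType) (A : act S) (f g : End A) :
  quasi_projective A -> range f `<=` range g -> exists h : End A, f = g * h.
Proof.
move=> qpA fg.
have surj_g (b : image_act g) :
    exists a, corestr (@subset_refl _ (range g)) a = b.
  by have [a _ gab] := svalP b; exists a; exact: image_ext.
have [h fgh] := qpA _ _ (corestr fg) surj_g.
by exists h; apply: hom_ext => a; exact: (congr1 sval (fgh a)).
Qed.

Theorem theorem4p8 (S : monoidType) (A : act S) :
  quasi_projective A ->
  strongly_coHopfian A ->
  (forall f g : End A, commute f g) ->
  strongly_Hopfian A.
Proof.
move=> qpA coA comA f; have [n n_gt0 im_fn] := coA f.
exists n => // m le_nm.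
have fmE : f ^+ m = f ^+ (m - n) * f ^+ n by rewrite -expgnDr subnK.
have im_fm : range (f ^+ m) `<=` range (f ^+ n).
  by rewrite fmE comA; exact: range_mul_subset.
have im_sub : im_rel (f ^+ n) `<=` im_rel (f ^+ m) by rewrite im_fn.
have [h fnE] :=
  quasi_projective_factor qpA (im_rel_subset_range im_fm im_sub).
rewrite eqEsubset; split.
  by rewrite fnE comA; exact: ker_rel_mul_subset.
by rewrite fmE; exact: ker_rel_mul_subset.
Qed.
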